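(* The generating function for $\frac12X_{C_{n,v}}$, where $C_{n,v}$ is the cycle $C_n$ twinned at a vertex $v$, has the following $e$-positive rational expression: $$\frac12\sum_{n\ge 3}X_{C_{n,v}}z^{n+1}=\sum_{i\ge 4}(2i^2-5i)e_iz^i+\frac{e_1z\,F_3+F_2\sum_{i\ge 3}(i-1)e_iz^i+e_2z^2\sum_{i\ge 3}(2i^2-6i+2)e_iz^i}{1-\sum_{i\ge 2}(i-1)e_iz^i},$$ where $F_2=\sum_{i\ge 3}(2i^2-5i)e_iz^i$ and $F_3=\sum_{i\ge 4}(i-1)(i-3)e_iz^i$.
   Context: The chromatic symmetric function of a finite simple graph $H=(V,E)$ is $X_H=\sum_\kappa\prod_{u\in V}x_{\kappa(u)}$, the sum over all proper colorings $\kappa:V\to\mathbb{Z}_{>0}$. $C_n$ is the cycle on $n$ vertices. The twin of a graph at a vertex $v$ is obtained by adding a new vertex $v'$ joined to $v$ and to all neighbors of $v$. $e_i$ is the $i$-th elementary symmetric function; a symmetric function is $e$-positive if its expansion in the elementary basis has nonnegative coefficients, and a power series in $z$ over symmetric functions is $e$-positive if each of its coefficients is. *)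

(* Defs.v *)
From HB Require Import structures.
From mathcomp Require Import all_boot all_order all_algebra.
From mathcomp Require Import finmap multiset.
From mathcomp Require Import boolp.

Set Implicit Arguments.
Unset Strict Implicit.
Unset Printing Implicit Defensive.

Import Order.TTheory GRing.Theory Num.Theory.
Local Open Scope ring_scope.

(* Formal power series in the variables x_0, x_1, ... over rat.  A monomial   *)
(* is the finite multiset of the indices of its variables, so its coefficient *)
(* map is a function on {mset nat}; symmetric functions live in this ring.    *)
(* The indices start at 0, so x_i here is the usual x_(i+1).                  *)

Definition monom : choiceType := {mset nat}%mset.

Record mps := MPS { mcoef : monom -> rat }.

HB.instance Definition _ := gen_eqMixin mps.
HB.instance Definition _ := gen_choiceMixin mps.

Lemma mpsP (f g : mps) : mcoef f =1 mcoef g -> f = g.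
Proof. by case: f g => [f] [g] /= /funext ->. Qed.

Definition mdivs (m : monom) : seq monom :=
  undup [seq seq_mset (mask (b : bitseq) (enum_mset m))
        | b : (size (enum_mset m)).-tuple bool].

Lemma mem_mdivs (a m : monom) : (a \in mdivs m) = (a `<=` m)%mset.
Proof.
rewrite mem_undup; apply/imageP/msubsetP => [[b _ ->] x|le_am].
  by rewrite mset_seqE -[X in (_ <= X)%N]count_mem_mset;
     exact/leq_count_subseq/mask_subseq.
have /count_subseqP[s' /subseqP[b sb ->] pas] :
    forall x, (count_mem x (enum_mset a) <= count_mem x (enum_mset m))%N.
  by move=> x; rewrite !count_mem_mset.
exists (Tuple (introT eqP sb)) => //=.
by rewrite -[LHS]seq_mset_id; apply/eq_seq_msetP.
Qed.

Lemma mdivs_uniq m : uniq (mdivs m). Proof. exact: undup_uniq. Qed.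

Definition mps_zero := MPS (fun=> 0).
Definition mps_opp f := MPS (fun m => - mcoef f m).
Definition mps_add f g := MPS (fun m => mcoef f m + mcoef g m).
Definition mps_one := MPS (fun m => (m == mset0)%:R).
Definition mps_mul f g :=
  MPS (fun m => \sum_(a <- mdivs m) mcoef f a * mcoef g (m `\` a)%mset).
Definition mps_scale (c : rat) f := MPS (fun m => c * mcoef f m).

Fact mps_addA : associative mps_add.
Proof. by move=> f g h; apply: mpsP => m /=; rewrite addrA. Qed.
Fact mps_addC : commutative mps_add.
Proof. by move=> f g; apply: mpsP => m /=; rewrite addrC. Qed.
Fact mps_add0 : left_id mps_zero mps_add.
Proof. by move=> f; apply: mpsP => m /=; rewrite add0r. Qed.
Fact mps_addN : left_inverse mps_zero mps_opp mps_add.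
Proof. by move=> f; apply: mpsP => m /=; rewrite addNr. Qed.

HB.instance Definition _ :=
  GRing.isZmodule.Build mps mps_addA mps_addC mps_add0 mps_addN.

Fact mps_mulC : commutative mps_mul.
Proof.
move=> f g; apply: mpsP => m /=.
rewrite [LHS](perm_big [seq (m `\` a)%mset | a <- mdivs m]) /=; last first.
  apply: uniq_perm; first exact: mdivs_uniq.
    rewrite map_inj_in_uniq ?mdivs_uniq // => a b.
    rewrite !mem_mdivs => am bm eq_ab.
    by rewrite -(msetBBK am) eq_ab msetBBK.
  move=> a; rewrite mem_mdivs; apply/idP/mapP => [am|[b _ ->]].
    by exists (m `\` a)%mset; rewrite ?msetBBK ?mem_mdivs ?msubsetDl.
  exact: msubsetDl.
rewrite big_map [LHS]big_seq [RHS]big_seq; apply: eq_bigr => a.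
by rewrite mem_mdivs => am; rewrite msetBBK // mulrC.
Qed.

Fact mps_mulA : associative mps_mul.
Proof.
move=> f g h; apply: mpsP => m /=.
under [RHS]eq_big_seq => a am.
  rewrite mulr_suml.
  rewrite (perm_big [seq b <- mdivs m | (b `<=` a)%mset]) /=; last first.
    apply: uniq_perm; rewrite ?filter_uniq ?mdivs_uniq // => b.
    rewrite mem_filter !mem_mdivs; apply/idP/andP => [ba|[]//]; split => //.
    by apply: (msubset_trans ba); rewrite -mem_mdivs.
  rewrite big_filter; over.
rewrite (exchange_big_dep xpredT) //=; apply: eq_big_seq => b.
rewrite mem_mdivs => bm; rewrite mulr_sumr -big_filter.
rewrite [RHS](perm_big [seq (b `+` c)%mset | c <- mdivs (m `\` b)%mset]) /=;
  last first.
  apply: uniq_perm; first by rewrite filter_uniq ?mdivs_uniq.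
    by rewrite map_inj_uniq ?mdivs_uniq //; apply: can_inj (@msetDKB _ b).
  move=> a; rewrite mem_filter mem_mdivs; apply/andP/mapP => [[ba am]|[c]].
    exists (a `\` b)%mset; last by rewrite msetBDKC.
    by rewrite mem_mdivs msetSB.
  rewrite mem_mdivs => cm ->; split.
    by apply/msubsetP => x; rewrite msetE2 leq_addr.
  by rewrite -(msetBDKC bm) msetDS.
by rewrite big_map; apply: eq_bigr => c _; rewrite msetDKB msetBDA mulrA.
Qed.

Fact mps_mul1 : left_id mps_one mps_mul.
Proof.
move=> f; apply: mpsP => m /=; rewrite (bigD1_seq mset0) ?mdivs_uniq //=.
  rewrite eqxx mul1r msetB0 big1 ?addr0 // => a /negbTE ->.
  by rewrite mul0r.
by rewrite mem_mdivs msub0set.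
Qed.

Fact mps_mulDl : left_distributive mps_mul mps_add.
Proof.
move=> f g h; apply: mpsP => m /=.
by rewrite -big_split; apply: eq_bigr => a _; rewrite /= mulrDl.
Qed.

Fact mps_oner_neq0 : mps_one != 0.
Proof.
apply/eqP => /(congr1 (fun f => mcoef f mset0)) /= /eqP.
by rewrite eqxx oner_eq0.
Qed.

HB.instance Definition _ := GRing.Zmodule_isComNzRing.Build mps
  mps_mulA mps_mulC mps_mul1 mps_mulDl mps_oner_neq0.

Fact mps_scaleA a b f : mps_scale a (mps_scale b f) = mps_scale (a * b) f.
Proof. by apply: mpsP => m /=; rewrite mulrA. Qed.
Fact mps_scale1 : left_id 1 mps_scale.
Proof. by move=> f; apply: mpsP => m /=; rewrite mul1r. Qed.
Fact mps_scaleDr : right_distributive mps_scale +%R.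
Proof. by move=> c f g; apply: mpsP => m /=; rewrite mulrDr. Qed.
Fact mps_scaleDl f : {morph mps_scale^~ f : a b / a + b}.
Proof. by move=> a b; apply: mpsP => m /=; rewrite mulrDl. Qed.

HB.instance Definition _ := GRing.Zmodule_isLmodule.Build rat mps
  mps_scaleA mps_scale1 mps_scaleDr mps_scaleDl.

Fact mps_scaleAl (c : rat) (f g : mps) : c *: (f * g) = (c *: f) * g.
Proof.
apply: mpsP => m /=; rewrite mulr_sumr.
by apply: eq_bigr => a _; rewrite mulrA.
Qed.

HB.instance Definition _ := GRing.Lmodule_isLalgebra.Build rat mps mps_scaleAl.
HB.instance Definition _ := GRing.Lalgebra_isComAlgebra.Build rat mps.

(* Formal power series in one variable z over a commutative ring R.           *)

Record zps (R : Type) := ZPS { zcoef : nat -> R }.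

HB.instance Definition _ (R : Type) := gen_eqMixin (zps R).
HB.instance Definition _ (R : Type) := gen_choiceMixin (zps R).

Lemma zpsP (R : Type) (f g : zps R) : zcoef f =1 zcoef g -> f = g.
Proof. by case: f g => [f] [g] /= /funext ->. Qed.

Section ZpsRing.
Variable R : comNzRingType.
Implicit Types f g h : zps R.

Definition zps_zero : zps R := ZPS (fun=> 0).
Definition zps_opp f := ZPS (fun n => - zcoef f n).
Definition zps_add f g := ZPS (fun n => zcoef f n + zcoef g n).
Definition zps_one : zps R := ZPS (fun n => (n == 0)%:R).
Definition zps_mul f g :=
  ZPS (fun n => \sum_(i < n.+1) zcoef f i * zcoef g (n - i)%N).
Definition zps_scale (c : R) f := ZPS (fun n => c * zcoef f n).

Fact zps_addA : associative zps_add.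
Proof. by move=> f g h; apply: zpsP => n /=; rewrite addrA. Qed.
Fact zps_addC : commutative zps_add.
Proof. by move=> f g; apply: zpsP => n /=; rewrite addrC. Qed.
Fact zps_add0 : left_id zps_zero zps_add.
Proof. by move=> f; apply: zpsP => n /=; rewrite add0r. Qed.
Fact zps_addN : left_inverse zps_zero zps_opp zps_add.
Proof. by move=> f; apply: zpsP => n /=; rewrite addNr. Qed.

HB.instance Definition _ :=
  GRing.isZmodule.Build (zps R) zps_addA zps_addC zps_add0 zps_addN.

Fact zps_mul_poly f g n N : (n < N)%N -> zcoef (zps_mul f g) n =
  ((\poly_(i < N) zcoef f i) * (\poly_(i < N) zcoef g i))`_n.
Proof.
move=> nN; rewrite coefM /=; apply: eq_bigr => i _.
by rewrite !coef_poly (leq_ltn_trans (leq_subr _ _)) ?(leq_trans _ nN).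
Qed.

Fact zps_mulC : commutative zps_mul.
Proof.
by move=> f g; apply: zpsP => n; rewrite !(zps_mul_poly _ _ (ltnSn n)) mulrC.
Qed.

Fact zps_mulA : associative zps_mul.
Proof.
move=> f g h; apply: zpsP => n.
pose P f := \poly_(i < n.+1) zcoef f i.
have PM f1 g1 i : (i < n.+1)%N -> (P (zps_mul f1 g1))`_i = (P f1 * P g1)`_i.
  by move=> iN; rewrite coef_poly iN (zps_mul_poly _ _ iN).
rewrite !(zps_mul_poly _ _ (ltnSn n)) -!/(P _).
transitivity ((P f * (P g * P h))`_n).
  by rewrite !coefM; apply: eq_bigr => i _; rewrite PM // ltnS leq_subr.
by rewrite mulrA !coefM; apply: eq_bigr => i _; rewrite PM.
Qed.

Fact zps_mul1 : left_id zps_one zps_mul.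
Proof.
move=> f; apply: zpsP => n /=; rewrite big_ord_recl /= mul1r subn0.
by rewrite big1 ?addr0 // => i _; rewrite mul0r.
Qed.

Fact zps_mulDl : left_distributive zps_mul zps_add.
Proof.
move=> f g h; apply: zpsP => n /=.
by rewrite -big_split; apply: eq_bigr => a _; rewrite /= mulrDl.
Qed.

Fact zps_oner_neq0 : zps_one != 0.
Proof.
apply/eqP => /(congr1 (fun f => zcoef f 0)) /= /eqP.
by rewrite oner_eq0.
Qed.

HB.instance Definition _ := GRing.Zmodule_isComNzRing.Build (zps R)
  zps_mulA zps_mulC zps_mul1 zps_mulDl zps_oner_neq0.

Fact zps_scaleA a b f : zps_scale a (zps_scale b f) = zps_scale (a * b) f.
Proof. by apply: zpsP => n /=; rewrite mulrA. Qed.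
Fact zps_scale1 : left_id 1 zps_scale.
Proof. by move=> f; apply: zpsP => n /=; rewrite mul1r. Qed.
Fact zps_scaleDr : right_distributive zps_scale +%R.
Proof. by move=> c f g; apply: zpsP => n /=; rewrite mulrDr. Qed.
Fact zps_scaleDl f : {morph zps_scale^~ f : a b / a + b}.
Proof. by move=> a b; apply: zpsP => n /=; rewrite mulrDl. Qed.

HB.instance Definition _ := GRing.Zmodule_isLmodule.Build R (zps R)
  zps_scaleA zps_scale1 zps_scaleDr zps_scaleDl.

Fact zps_scaleAl (c : R) (f g : zps R) : c *: (f * g) = (c *: f) * g.
Proof.
apply: zpsP => n /=; rewrite mulr_sumr.
by apply: eq_bigr => i _; rewrite mulrA.
Qed.

HB.instance Definition _ :=
  GRing.Lmodule_isLalgebra.Build R (zps R) zps_scaleAl.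
HB.instance Definition _ := GRing.Lalgebra_isComAlgebra.Build R (zps R).

(* Units and inverses are those of the ring zps R, picked classically; see    *)
(* zps_unit1 for the case needed to read f / (1 - g) as a power series.       *)
Definition zps_unit : pred (zps R) := fun f => `[< exists g, g * f = 1 >].
Definition zps_inv f : zps R :=
  if pselect (exists g, g * f = 1) is left ex then projT1 (cid ex) else f.

Fact zps_mulVr : {in zps_unit, left_inverse 1 zps_inv *%R}.
Proof.
move=> f /asboolP uf; rewrite /zps_inv; case: pselect => // ex.
exact: (projT2 (cid ex)).
Qed.

Fact zps_unitP f g : g * f = 1 -> zps_unit f.
Proof. by move=> fg; apply/asboolP; exists g. Qed.

Fact zps_inv_out : {in [predC zps_unit], zps_inv =1 id}.
Proof.
move=> f; rewrite inE => /asboolP nu; rewrite /zps_inv.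
by case: pselect.
Qed.

HB.instance Definition _ := GRing.ComNzRing_hasMulInverse.Build (zps R)
  zps_mulVr zps_unitP zps_inv_out.

Definition zvar : zps R := ZPS (fun n => (n == 1)%:R).

(* sum_ge k a is the series sum_(i >= k) a_i z^i.                             *)
Definition sum_ge (k : nat) (a : nat -> R) : zps R :=
  ZPS (fun n => if (k <= n)%N then a n else 0).

Lemma zps_unit1 f : zcoef f 0 = 1 -> f \is a GRing.unit.
Proof.
move=> f0; pose step (s : seq R) :=
  rcons s (- \sum_(i < size s) s`_i * zcoef f (size s - i)%N).
pose s n := iter n step [:: 1].
have size_s n : size (s n) = n.+1.
  by elim: n => //= n IHn; rewrite size_rcons IHn.
have sE n k i : (i <= n)%N -> (s (k + n)%N)`_i = (s n)`_i.
  move=> le_in; elim: k => //= k <-; rewrite nth_rcons size_s.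
  by rewrite ltnS (leq_trans le_in (leq_addl _ _)).
apply/(zps_unitP (g := ZPS (fun n => (s n)`_n)))/zpsP => -[|n] /=.
  by rewrite big_ord_recl big_ord0 /= f0 mulr1 addr0.
rewrite big_ord_recr /= subnn f0 mulr1 nth_rcons size_s ltnn eqxx.
apply/eqP; rewrite subr_eq0; apply/eqP/eq_bigr => i _; congr (_ * _).
by rewrite -(@sE i (n - i)%N) // subnK // -ltnS.
Qed.

End ZpsRing.

Arguments zvar {R}.

Record sgraph := SGraph {
  vertex :> finType;
  edge : rel vertex;
  edge_sym : symmetric edge;
  edge_irr : irreflexive edge
}.

Section Cycle.
Variable n : nat.

(* The conjunct i != j only matters for n = 1.                                *)
Definition cycle_edge : rel 'I_n :=
  [rel i j | (i != j) && ((ordS i == j) || (ordS j == i))].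

Fact cycle_edge_sym : symmetric cycle_edge.
Proof. by move=> i j; rewrite /cycle_edge /= eq_sym orbC. Qed.
Fact cycle_edge_irr : irreflexive cycle_edge.
Proof. by move=> i; rewrite /cycle_edge /= eqxx. Qed.

Definition cycle_graph := SGraph cycle_edge_sym cycle_edge_irr.
End Cycle.

Section Twin.
Variables (G : sgraph) (v : G).

(* None is the new vertex v'.                                                 *)
Definition twin_edge : rel (option G) := fun x y =>
  match x, y with
  | Some x, Some y => edge x y
  | None, Some u | Some u, None => (u == v) || edge v u
  | None, None => false
  end.

Fact twin_edge_sym : symmetric twin_edge.
Proof. by move=> [x|] [y|] //=; rewrite edge_sym. Qed.
Fact twin_edge_irr : irreflexive twin_edge.
Proof. by move=> [x|] //=; rewrite edge_irr. Qed.

Definition twin := SGraph twin_edge_sym twin_edge_irr.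
End Twin.

Definition proper_coloring (G : sgraph) (C : eqType) (kappa : G -> C) :=
  [forall x, forall y, edge x y ==> (kappa x != kappa y)].

(* The coefficient of a monomial m counts the proper colorings kappa whose    *)
(* product of x_(kappa u) is m; such a kappa takes its values among the       *)
(* indices of the variables of m.                                             *)
Definition chromatic_symfun (G : sgraph) : mps := MPS (fun m : {mset nat}%mset =>
  #|[set kappa : {ffun G -> finsupp m} |
      proper_coloring kappa
      && (seq_mset [seq val (kappa u) | u : G] == m)]|%:R).

Definition elem (k : nat) : mps :=
  MPS (fun m => ((size (enum_mset m) == k) && uniq (enum_mset m))%:R).

Definition is_partition (la : seq nat) := sorted geq la && (0%N \notin la).

Definition elem_part (la : seq nat) : mps := \prod_(i <- la) elem i.

Definition e_positive (f : mps) := exists (s : seq (seq nat)) (c : seq nat -> rat),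
  [/\ uniq s, all is_partition s, {in s, forall la, 0 <= c la}
    & f = \sum_(la <- s) c la *: elem_part la].

Definition e_positive_zps (F : zps mps) := forall n, e_positive (zcoef F n).

(* sum_(n >= 3) X_(C_(n, v)) z^(n+1), where n = k.+3 and the cycle on n       *)
(* vertices is twinned at its vertex v k.                                     *)
Definition twinned_cycle_gf (v : forall k, 'I_k.+3) : zps mps :=
  ZPS (fun d => if d is k.+4 then
    chromatic_symfun (twin (v k : cycle_graph k.+3)) else 0).

(* Main.v *)
Require Import Defs.
From mathcomp Require Import all_boot all_order all_algebra finmap multiset.
From mathcomp Require Import ring lra.

(* Write E(z) = sum_i e_i z^i and D = E - z E', so that the denominator is D. *)
(* With finitely many colours a, E is the product of the 1 + x_a z.           *)
(*                                                                            *)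
(* Cutting off the first letter of a word without equal adjacent letters gives*)
(* linear equations for the generating functions of such words by first and   *)
(* last letter.  Solving them yields P D = E for the paths and                *)
(* Z D = z^2 E'' for the cycles.                                              *)
(*                                                                            *)
(* Triple deletion at the twins (if a <> b then [a <> y][b <> y] equals       *)
(* [a <> y] + [b <> y] - 1) reduces the twinned cycle to paths and cycles:    *)
(*   X_(C_(n,v)) / 2                                                          *)
(*     = 2 X_(C_(n+1)) + e_1 X_(C_n) - 3 X_(P_(n+1)) + e_2 X_(P_(n-1)).       *)
(* The rational expression follows by algebra.  It passes to infinitely many  *)
(* variables because killing the variables x_i with i >= N is a ring morphism *)
(* and these morphisms are jointly injective.                                 *)

(** A proper coloring of the twinned cycle is a cyclic word for the cycle together with one letter
    for the new vertex ([chromatic_fin_twin]). The linear equations are solved in [path_gfE] and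
    [cycle_gfE], the triple deletion is [twin_wordE], and the concluding algebra, with the
    denominator cleared, is [twin_gf_rational]. [restrict_elem] and [restrict_chromatic] identify
    the finite-variable images, and [zrestrict_inj] lifts the identity.

    Positivity is then read off the rational expression: each displayed coefficient is nonnegative
    from its starting index on, and [1 / (1 - G)] is e-positive when [G] is e-positive without
    constant term ([ecomb_zpsV]). *)

Set Implicit Arguments.
Unset Strict Implicit.
Unset Printing Implicit Defensive.

Import Order.TTheory GRing.Theory Num.Theory.
Local Open Scope ring_scope.

(** * Power series *)

Section PowerSeries.
Variable R : comNzRingType.
Implicit Types f g : zps R.

Lemma zcoefD f g n : zcoef (f + g) n = zcoef f n + zcoef g n.
Proof. by []. Qed.

Lemma zcoefB f g n : zcoef (f - g) n = zcoef f n - zcoef g n.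
Proof. by []. Qed.

Lemma zcoefZ c f n : zcoef (c *: f) n = c * zcoef f n.
Proof. by []. Qed.

Lemma zcoefM f g n :
  zcoef (f * g) n = \sum_(i < n.+1) zcoef f i * zcoef g (n - i)%N.
Proof. by []. Qed.

Lemma zcoef1 n : zcoef (1 : zps R) n = (n == 0)%:R.
Proof. by []. Qed.

Lemma zcoef_sum (I : Type) (r : seq I) (p : pred I) (F : I -> zps R) n :
  zcoef (\sum_(i <- r | p i) F i) n = \sum_(i <- r | p i) zcoef (F i) n.
Proof. exact: (big_morph (fun f => zcoef f n)). Qed.

Lemma zcoef_zvarM f n : zcoef (zvar * f) n = if n is k.+1 then zcoef f k else 0.
Proof.
rewrite zcoefM big_ord_recl /= mul0r add0r.
case: n => [|n]; first by rewrite big_ord0.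
rewrite big_ord_recl /= mul1r subSS subn0 big1 ?addr0 // => i _.
by rewrite mul0r.
Qed.

Lemma zcoef_zvarXM k f n :
  zcoef (zvar ^+ k * f) n = if (k <= n)%N then zcoef f (n - k) else 0.
Proof.
elim: k n => [|k IHk] n; first by rewrite mul1r subn0.
by rewrite exprS -mulrA zcoef_zvarM; case: n => [|n] //; rewrite IHk.
Qed.

Lemma zcoef_zvarX k n : zcoef (zvar ^+ k : zps R) n = (n == k)%:R.
Proof.
rewrite -[zvar ^+ k]mulr1 zcoef_zvarXM zcoef1.
case: leqP => [le_kn|lt_nk]; last by rewrite ltn_eqF.
by rewrite subn_eq0 eqn_leq le_kn andbT.
Qed.

Lemma zcoef0M f g : zcoef (f * g) 0 = zcoef f 0 * zcoef g 0.
Proof. by rewrite zcoefM big_ord1. Qed.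

(** The Euler operator [z d/dz]; thus [theta (theta f) - theta f] is [z^2 f'']. *)
Definition theta f := ZPS (fun n => n%:R * zcoef f n).

Lemma thetaD f g : theta (f + g) = theta f + theta g.
Proof. by apply: zpsP => n /=; rewrite mulrDr. Qed.

Lemma theta1 : theta 1 = 0.
Proof. by apply: zpsP => -[|n] /=; rewrite ?mul0r ?mulr0. Qed.

Lemma theta_zvar c : theta (c *: zvar) = c *: zvar.
Proof. by apply: zpsP => -[|[|n]] /=; rewrite ?mulr0 ?mul1r. Qed.

Lemma thetaM f g : theta (f * g) = theta f * g + f * theta g.
Proof.
apply: zpsP => n; rewrite /= mulr_sumr -big_split /=; apply: eq_bigr => i _.
have {1}-> : n = (i + (n - i))%N by rewrite subnKC // -ltnS.
by rewrite natrD; ring.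
Qed.

Lemma theta_sum (I : Type) (r : seq I) (p : pred I) (F : I -> zps R) :
  theta (\sum_(i <- r | p i) F i) = \sum_(i <- r | p i) theta (F i).
Proof.
apply: (big_morph _ thetaD).
by apply: zpsP => n /=; rewrite mulr0.
Qed.

Lemma zcoefM1 f g :
  zcoef (f * g) 1 = zcoef f 0 * zcoef g 1 + zcoef f 1 * zcoef g 0.
Proof. by rewrite zcoefM !big_ord_recl big_ord0 /= addr0. Qed.

Lemma zcoefM2 f g : zcoef (f * g) 2 =
  zcoef f 0 * zcoef g 2 + zcoef f 1 * zcoef g 1 + zcoef f 2 * zcoef g 0.
Proof. by rewrite zcoefM !big_ord_recl big_ord0 /= addr0 !addrA. Qed.

Lemma zcoefM3 f g : zcoef (f * g) 3 =
  zcoef f 0 * zcoef g 3 + zcoef f 1 * zcoef g 2 + zcoef f 2 * zcoef g 1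
  + zcoef f 3 * zcoef g 0.
Proof. by rewrite zcoefM !big_ord_recl big_ord0 /= addr0 !addrA. Qed.

Lemma zcoef_natM k f n :
  zcoef (k%:R * f) n = k%:R * zcoef f n.
Proof.
elim: k => [|k IHk]; first by rewrite !mul0r.
by rewrite -natr1 mulrDl zcoefD IHk mul1r -natr1 mulrDl mul1r.
Qed.

Lemma zcoefN f n : zcoef (- f) n = - zcoef f n.
Proof. by []. Qed.

Lemma zcoef_monomM (c : R) k f n :
  zcoef (c *: zvar ^+ k * f) n = if (k <= n)%N then c * zcoef f (n - k) else 0.
Proof.
by rewrite -scalerAl zcoefZ zcoef_zvarXM; case: ifP => // _; rewrite mulr0.
Qed.

Lemma zcoef_monom (c : R) k n :
  zcoef (c *: zvar ^+ k) n = if n == k then c else 0.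
Proof.
by rewrite zcoefZ zcoef_zvarX; case: ifP => _; rewrite ?mulr1 ?mulr0.
Qed.

Lemma sum_ge4E (a : nat -> R) :
  sum_ge 4 a = sum_ge 3 a - a 3 *: zvar ^+ 3.
Proof.
apply: zpsP => n; rewrite zcoefB zcoef_monom /=.
by case: n => [|[|[|[|n]]]]; rewrite /= ?subr0 ?subrr.
Qed.

Lemma eq_sum_ge k (a b : nat -> R) : a =1 b -> sum_ge k a = sum_ge k b.
Proof. by move=> eq_ab; apply: zpsP => n /=; rewrite eq_ab. Qed.

End PowerSeries.

(** * Words without equal adjacent letters *)

Section Words.
Variables (R : comNzRingType) (C : finType) (x : C -> R).

Definition neq : rel C := fun a b => a != b.
Definition weight (s : seq C) : R := \prod_(i <- s) x i.
(** The summand is a function on plain sequences, so that letters can be split off at either end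
    without casts between tuple types. *)
Definition wsum n (F : seq C -> R) : R := \sum_(t : n.-tuple C) F t.

Lemma eq_wsum n F G :
  (forall s, size s = n -> F s = G s) -> wsum n F = wsum n G.
Proof. by move=> eqFG; apply: eq_bigr => t _; rewrite eqFG ?size_tuple. Qed.

Lemma wsum0 F : wsum 0 F = F [::].
Proof.
rewrite /wsum (big_pred1 [tuple]) //= => t.
by apply/esym/eqP; exact: tuple0.
Qed.

Lemma wsum_cons n F : wsum n.+1 F = \sum_a wsum n (fun s => F (a :: s)).
Proof.
rewrite /wsum pair_big /=.
rewrite (reindex (fun p : C * n.-tuple C => cons_tuple p.1 p.2)) //.
exists (fun t : n.+1.-tuple C => (thead t, behead_tuple t)) => [[a t] _|t _].
  by congr (_, _); apply: val_inj.
by rewrite [RHS](tuple_eta t); apply: val_inj.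
Qed.

Lemma wsum_rcons n F : wsum n.+1 F = \sum_a wsum n (fun s => F (rcons s a)).
Proof.
elim: n F => [|n IHn] F.
  by rewrite wsum_cons; apply: eq_bigr => a _; rewrite !wsum0.
rewrite wsum_cons; under eq_bigr do rewrite IHn.
by rewrite exchange_big; apply: eq_bigr => a _; rewrite wsum_cons.
Qed.

Lemma mulr_wsumr n c F : c * wsum n F = wsum n (fun s => c * F s).
Proof. exact: mulr_sumr. Qed.

Lemma wsumD n F G : wsum n (fun s => F s + G s) = wsum n F + wsum n G.
Proof. exact: big_split. Qed.

Lemma wsumB n F G : wsum n (fun s => F s - G s) = wsum n F - wsum n G.
Proof. exact: sumrB. Qed.

Lemma weight_cons a s : weight (a :: s) = x a * weight s.
Proof. exact: big_cons. Qed.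

Lemma weight_rcons a s : weight (rcons s a) = x a * weight s.
Proof. by rewrite /weight -cats1 big_cat big_seq1 /= mulrC. Qed.

(** The condition [l] on the last letter lets one recurrence serve both paths ([predT]) and cycles
    ([predC1 a]). *)
Definition words_from (l : pred C) a : zps R := ZPS (fun n =>
  if n is k.+1 then
    wsum k (fun s => (path neq a s && l (last a s))%:R * weight (a :: s))
  else 0).

Definition egf : zps R := \prod_a (1 + x a *: zvar).
Definition egfD1 a : zps R := \prod_(b | b != a) (1 + x b *: zvar).
Definition eden : zps R := egf - theta egf.

Lemma egf_D1 a : egf = (1 + x a *: zvar) * egfD1 a.
Proof. exact: bigD1. Qed.

Lemma theta_egf : theta egf = \sum_a x a *: zvar * egfD1 a.
Proof.
rewrite /egf /egfD1.
(* The factor to be omitted is recognised by its letter, so the induction runs over duplicate-free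
   lists. *)
have th (r : seq C) : uniq r -> theta (\prod_(a <- r) (1 + x a *: zvar)) =
    \sum_(a <- r) x a *: zvar * \prod_(b <- r | b != a) (1 + x b *: zvar).
  elim: r => [|a r IHr]; first by rewrite !big_nil theta1.
  rewrite [uniq _]/= => /andP[a_r /IHr {}IHr].
  rewrite big_cons thetaM IHr thetaD theta1 theta_zvar add0r [RHS]big_cons.
  congr (_ * _ + _).
    rewrite big_cons eqxx /= big_seq [RHS]big_seq_cond; apply: eq_bigl => b.
    by case: (boolP (b \in r)) => //= b_r; apply/esym/(memPn a_r).
  rewrite mulr_sumr; apply: eq_big_seq => b b_r.
  by rewrite big_cons eq_sym (memPn a_r) //; ring.
by rewrite [LHS]th // index_enum_uniq.
Qed.

(** After the first letter [a] the word either stops or continues with some [b] distinct from [a].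
    Adding the missing term [b = a] to both sides produces the factor [1 + x a *: zvar]. *)
Lemma words_from_rec l a : (1 + x a *: zvar) * words_from l a =
  x a *: zvar * ((l a)%:R + \sum_b words_from l b).
Proof.
apply: zpsP => n; rewrite mulrDl mul1r -!scalerAl zcoefD !zcoefZ !zcoef_zvarM.
case: n => [|[|n]]; rewrite ?mulr0 ?addr0 // zcoefD zcoef_sum /=.
  rewrite wsum0 /= weight_cons /weight big_nil mulr1 big1 // addr0 mulrC.
  by case: (l a); rewrite ?mulr1.
set c := zcoef _ _; have -> : c = 0 by rewrite /c; case: (l a).
rewrite add0r wsum_cons (bigD1 a) //= [in RHS](bigD1 a) //= mulrDr addrC.
rewrite [X in _ + X + _]big1 => [|s _]; last by rewrite /neq eqxx mul0r.
rewrite addr0 addrC; congr (_ + _); rewrite mulr_sumr; apply: eq_bigr => b ba.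
rewrite mulr_wsumr; apply: eq_wsum => s _.
by rewrite /neq eq_sym ba /= (weight_cons a); ring.
Qed.

(** Multiplying the recurrence for [a] by [egfD1 a] turns its left factor into [egf]. Summing over
    [a] gives [E S = sum + theta(E) S], which is solved for the total [S]. *)
Lemma sum_words_from l : eden * \sum_a words_from l a =
  \sum_a (l a)%:R * (x a *: zvar * egfD1 a).
Proof.
set S := \sum_a _; rewrite /eden mulrBl; apply/eqP; rewrite subr_eq; apply/eqP.
rewrite {1}/S mulr_sumr theta_egf mulr_suml -big_split /=.
apply: eq_bigr => a _.
by rewrite (egf_D1 a) mulrAC words_from_rec -/S; ring.
Qed.

(** Substituting the known total into the recurrence for [a] leaves the invertible factor
    [1 + x a *: zvar] on both sides, and it cancels. *)
Lemma words_from_pred1 a :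
  eden * words_from (pred1 a) a = x a *: zvar * (egfD1 a - theta (egfD1 a)).
Proof.
set u := 1 + x a *: zvar; set y := x a *: zvar.
have uU : u \is a GRing.unit by apply: zps_unit1; rewrite /= mulr0 addr0.
apply: (mulrI uU); rewrite mulrCA words_from_rec -/y /=.
set S := \sum_b _.
have DS : eden * S = y * egfD1 a.
  rewrite sum_words_from (bigD1 a) //= eqxx mul1r big1 ?addr0 // => b /negbTE->.
  by rewrite mul0r.
rewrite eqxx mulrCA mulrDr DS /eden (egf_D1 a) -/u thetaM.
by rewrite /u thetaD theta1 theta_zvar -/y mulr1; ring.
Qed.

Definition path_gf : zps R := 1 + \sum_a words_from predT a.
Definition cycle_gf : zps R := \sum_a words_from (predC1 a) a.

Lemma path_gfE : path_gf * eden = egf.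
Proof.
rewrite /path_gf mulrDl mul1r mulrC sum_words_from.
under eq_bigr do rewrite mul1r.
by rewrite -theta_egf /eden subrK.
Qed.

(** Closed words are all words minus those whose last letter equals the first. The difference is
    [sum_a x_a z theta(egfD1 a)], which also appears when [theta] is applied to [theta_egf]. *)
Lemma cycle_gfE : cycle_gf * eden = theta (theta egf) - theta egf.
Proof.
have -> : cycle_gf = \sum_a words_from predT a - \sum_a words_from (pred1 a) a.
  rewrite -sumrB; apply: eq_bigr => a _; apply: zpsP => -[|n].
    by rewrite zcoefB /= subr0.
  rewrite zcoefB /= -wsumB; apply: eq_wsum => s _; rewrite -mulrBl andbT.
  by case: path; case: (last a s == a); rewrite /= ?subr0 ?subrr.
rewrite mulrC mulrBr sum_words_from mulr_sumr.
under eq_bigr do rewrite mul1r.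
under [X in _ - X]eq_bigr do rewrite words_from_pred1 mulrBr.
rewrite sumrB -theta_egf opprB addrCA subrr addr0.
rewrite [X in theta X]theta_egf theta_sum.
under [X in _ = X - _]eq_bigr do rewrite thetaM theta_zvar.
by rewrite big_split /= -theta_egf addrAC subrr add0r.
Qed.

Local Notation P := path_gf.
Local Notation Z := cycle_gf.
Local Notation E := egf.
Local Notation D := eden.

Lemma neqC a b : neq a b = neq b a.
Proof. exact: (congr1 negb (eq_sym a b)). Qed.

Lemma natr_andb (p q : bool) : (p && q)%:R = p%:R * q%:R :> R.
Proof. by rewrite -mulnb natrM. Qed.

Lemma zcoef_path_gf n :
  zcoef P n = wsum n (fun s => (sorted neq s)%:R * weight s).
Proof.
rewrite /path_gf zcoefD zcoef1 zcoef_sum; case: n => [|n].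
  by rewrite wsum0 /weight big_nil mulr1 big1 ?addr0.
rewrite add0r wsum_cons; apply: eq_bigr => a _; apply: eq_wsum => s _.
by rewrite andbT.
Qed.

(** Degree 0 is excluded: the empty word satisfies [cycle], but the series has no constant term. *)
Lemma zcoef_cycle_gf n :
  zcoef Z n.+1 = wsum n.+1 (fun s => (cycle neq s)%:R * weight s).
Proof.
rewrite /cycle_gf zcoef_sum wsum_cons; apply: eq_bigr => a _.
by apply: eq_wsum => s _; rewrite /= rcons_path.
Qed.

Lemma zcoef_egf0 : zcoef E 0 = 1.
Proof.
rewrite /egf; elim/big_rec: _ => // a f _ f0.
by rewrite zcoef0M f0 /= mulr0 addr0 mulr1.
Qed.

Lemma zcoef_eden n : zcoef D n = (1 - n%:R) * zcoef E n.
Proof. by rewrite mulrBl mul1r. Qed.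

Lemma path_gf0 : zcoef P 0 = 1.
Proof. by rewrite zcoef_path_gf wsum0 /weight big_nil mulr1. Qed.

(** Read off from [P D = E], since [D] starts with [1 + 0 z]. These values and those of
    [cycle_gf_low] correct for the degrees below 4, where the twinned series vanishes. *)
Lemma path_gf_low : [/\ zcoef P 1 = zcoef E 1, zcoef P 2 = 2 * zcoef E 2
  & zcoef P 3 = 3 * zcoef E 3 + zcoef E 1 * zcoef E 2].
Proof.
have PE n : zcoef (P * D) n = zcoef E n by rewrite path_gfE.
have P1 : zcoef P 1 = zcoef E 1.
  by rewrite -PE zcoefM1 path_gf0 !zcoef_eden zcoef_egf0; ring.
have P2 : zcoef P 2 = 2 * zcoef E 2.
  have -> : zcoef P 2 = zcoef (P * D) 2 + zcoef E 2; last by rewrite PE; ring.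
  by rewrite zcoefM2 P1 path_gf0 !zcoef_eden zcoef_egf0; ring.
split=> //; have -> : zcoef P 3
    = zcoef (P * D) 3 + 2 * zcoef E 3 + zcoef E 1 * zcoef E 2.
  by rewrite zcoefM3 P1 P2 path_gf0 !zcoef_eden zcoef_egf0; ring.
by rewrite PE; ring.
Qed.

Lemma cycle_gf_low : [/\ zcoef Z 0 = 0, zcoef Z 1 = 0,
  zcoef Z 2 = 2 * zcoef E 2 & zcoef Z 3 = 6 * zcoef E 3].
Proof.
have ZE n : zcoef (Z * D) n = n%:R * (n%:R * zcoef E n) - n%:R * zcoef E n.
  by rewrite cycle_gfE.
have Z0 : zcoef Z 0 = 0 by rewrite /cycle_gf zcoef_sum big1.
have Z1 : zcoef Z 1 = 0.
  have -> : zcoef Z 1 = zcoef (Z * D) 1; last by rewrite ZE; ring.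
  by rewrite zcoefM1 Z0 !zcoef_eden zcoef_egf0; ring.
split=> //.
  have -> : zcoef Z 2 = zcoef (Z * D) 2; last by rewrite ZE; ring.
  by rewrite zcoefM2 Z0 Z1 !zcoef_eden zcoef_egf0; ring.
have -> : zcoef Z 3 = zcoef (Z * D) 3; last by rewrite ZE; ring.
by rewrite zcoefM3 Z0 Z1 !zcoef_eden zcoef_egf0; ring.
Qed.

(** Here [t] lists the colours round the cycle from the twinned vertex on, and [b] colours the new
    vertex, which sees that vertex and its two cyclic neighbours. *)
Definition twin_word (b : C) (t : seq C) : bool :=
  if t is a :: u then
    [&& neq b a, neq b (head a u), neq (last a u) b & cycle neq t]
  else false.

(** * Triple deletion at the twins *)

Section Deletion.
Variable j : nat.

(* In F b a y l, the twins have colours a and b, and the end vertices of the  *)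
(* path left after deleting them have colours y and l.                        *)
Definition colsum (F : C -> C -> C -> C -> R) : R :=
  \sum_b \sum_a \sum_y wsum j (fun s =>
    F b a y (last y s) * ((path neq y s)%:R * weight [:: b, a, y & s])).

Lemma eq_colsum F G :
  (forall b a y l, F b a y l = G b a y l) -> colsum F = colsum G.
Proof.
move=> eqFG; apply: eq_bigr => b _; apply: eq_bigr => a _.
by apply: eq_bigr => y _; apply: eq_wsum => s _; rewrite eqFG.
Qed.

Lemma colsumD F G :
  colsum (fun b a y l => F b a y l + G b a y l) = colsum F + colsum G.
Proof.
rewrite -big_split; apply: eq_bigr => b _; rewrite -big_split.
apply: eq_bigr => a _; rewrite -big_split /=; apply: eq_bigr => y _.
by rewrite -wsumD; apply: eq_wsum => s _; rewrite mulrDl.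
Qed.

Lemma colsumB F G :
  colsum (fun b a y l => F b a y l - G b a y l) = colsum F - colsum G.
Proof.
rewrite -sumrB; apply: eq_bigr => b _; rewrite -sumrB.
apply: eq_bigr => a _; rewrite -sumrB; apply: eq_bigr => y _.
by rewrite -wsumB; apply: eq_wsum => s _; rewrite mulrBl.
Qed.

Lemma colsum_swap F : colsum F = colsum (fun b a => F a b).
Proof.
rewrite /colsum exchange_big; apply: eq_bigr => b _; apply: eq_bigr => a _.
by apply: eq_bigr => y _; apply: eq_wsum => s _; rewrite !weight_cons; ring.
Qed.

Local Notation "a # b" := (neq a b)%:R (at level 35).

Lemma colsum_twin : \sum_b wsum j.+2 (fun t =>
    (twin_word b t)%:R * (x b * weight t)) =
  colsum (fun b a y l => b # a * (a # y * b # y) * (l # a * l # b)).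
Proof.
apply: eq_bigr => b _; rewrite wsum_cons; apply: eq_bigr => a _.
rewrite wsum_cons; apply: eq_bigr => y _; apply: eq_wsum => s _.
by rewrite /= rcons_path -weight_cons !natr_andb; ring.
Qed.

(** This and the next two lemmas read the same path coefficient from the words [b a y s], [y s a b]
    and [a y s b]. *)
Lemma colsum_path_front : colsum (fun b a y l => b # a * a # y) = zcoef P j.+3.
Proof.
rewrite zcoef_path_gf wsum_cons; apply: eq_bigr => b _.
rewrite wsum_cons; apply: eq_bigr => a _.
rewrite wsum_cons; apply: eq_bigr => y _; apply: eq_wsum => s _.
by rewrite /= !natr_andb; ring.
Qed.

Lemma colsum_path_back : colsum (fun b a y l => b # a * l # a) = zcoef P j.+3.
Proof.
rewrite zcoef_path_gf wsum_rcons; apply: eq_bigr => b _.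
rewrite wsum_rcons; apply: eq_bigr => a _.
rewrite wsum_cons; apply: eq_bigr => y _; apply: eq_wsum => s _.
rewrite !weight_rcons !weight_cons /= !rcons_path last_rcons !natr_andb.
by rewrite (neqC a b); ring.
Qed.

Lemma colsum_path_both : colsum (fun b a y l => a # y * l # b) = zcoef P j.+3.
Proof.
rewrite zcoef_path_gf wsum_rcons; apply: eq_bigr => b _.
rewrite wsum_cons; apply: eq_bigr => a _.
rewrite wsum_cons; apply: eq_bigr => y _; apply: eq_wsum => s _.
by rewrite weight_rcons !weight_cons /= rcons_path !natr_andb; ring.
Qed.

Lemma colsum_cycle :
  colsum (fun b a y l => b # a * (a # y * l # b)) = zcoef Z j.+3.
Proof.
rewrite zcoef_cycle_gf wsum_cons; apply: eq_bigr => b _.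
rewrite wsum_cons; apply: eq_bigr => a _.
rewrite wsum_cons; apply: eq_bigr => y _; apply: eq_wsum => s _.
by rewrite /= rcons_path !natr_andb; ring.
Qed.

Lemma zcoef_egf1 : \sum_a x a = zcoef E 1.
Proof.
have [<- _ _] := path_gf_low; rewrite zcoef_path_gf wsum_cons.
apply: eq_bigr => a _.
by rewrite wsum0 weight_cons /weight big_nil /= mulr1 mul1r.
Qed.

Lemma zcoef_egf2 : \sum_b \sum_a b # a * (x b * x a) = 2 * zcoef E 2.
Proof.
have [_ <- _] := path_gf_low; rewrite zcoef_path_gf wsum_cons.
apply: eq_bigr => b _; rewrite wsum_cons; apply: eq_bigr => a _.
by rewrite wsum0 !weight_cons /weight big_nil /= mulr1 andbT.
Qed.

(** The twin [b] is isolated, while [a y s] closes up to a cycle. *)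
Lemma colsum_disjoint_vertex :
  colsum (fun b a y l => a # y * l # a) = zcoef E 1 * zcoef Z j.+2.
Proof.
rewrite -zcoef_egf1 mulr_suml; apply: eq_bigr => b _.
rewrite zcoef_cycle_gf wsum_cons mulr_sumr; apply: eq_bigr => a _.
rewrite wsum_cons mulr_sumr; apply: eq_bigr => y _; rewrite mulr_wsumr.
apply: eq_wsum => s _.
by rewrite /= rcons_path !natr_andb !weight_cons; ring.
Qed.

Lemma colsum_disjoint_edge :
  colsum (fun b a y l => b # a) = 2 * zcoef E 2 * zcoef P j.+1.
Proof.
rewrite -zcoef_egf2 mulr_suml; apply: eq_bigr => b _.
rewrite mulr_suml; apply: eq_bigr => a _.
rewrite zcoef_path_gf wsum_cons mulr_sumr; apply: eq_bigr => y _.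
by rewrite mulr_wsumr; apply: eq_wsum => s _; rewrite /= !weight_cons; ring.
Qed.

(* Pointwise triple deletion: [b # a * l # a - l # a] vanishes unless a = b,  *)
(* where l # a = l # b.                                                       *)
Lemma colsum_pendant : colsum (fun b a y l => b # a * (a # y * l # a)) =
  zcoef E 1 * zcoef Z j.+2 + zcoef Z j.+3 - zcoef P j.+3.
Proof.
rewrite -colsum_disjoint_vertex -colsum_cycle -colsum_path_both.
rewrite -colsumD -colsumB; apply: eq_colsum => b a y l.
rewrite /neq; case: (eqVneq b a) => [->|_] /=; ring.
Qed.

(* Since a != b, a vertex cannot share its colour with both twins, so         *)
(* [a # y * b # y = a # y + b # y - 1], and likewise for l.                   *)
Lemma twin_wordE : \sum_b wsum j.+2 (fun t =>
    (twin_word b t)%:R * (x b * weight t)) =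
  2 * (2 * zcoef Z j.+3 + zcoef E 1 * zcoef Z j.+2
       - 3 * zcoef P j.+3 + zcoef E 2 * zcoef P j.+1).
Proof.
pose T F := colsum (fun b a y l => b # a * F b a y l).
have swap F : T F = T (fun b a => F a b).
  rewrite /T colsum_swap; apply: eq_colsum => b a y l.
  by rewrite (neqC a b).
rewrite colsum_twin.
(* The product of the two three-term expansions has nine terms. Exchanging the twins pairs eight of
   them, which gives the overall factor 2; the ninth contributes [2 e_2] times a path. *)
have -> : colsum (fun b a y l => b # a * (a # y * b # y) * (l # a * l # b)) =
  T (fun b a y l => a # y * l # a) + T (fun b a y l => b # y * l # b)
  + T (fun b a y l => a # y * l # b) + T (fun b a y l => b # y * l # a)
  - T (fun b a y l => a # y) - T (fun b a y l => b # y)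
  - T (fun b a y l => l # a) - T (fun b a y l => l # b)
  + colsum (fun b a y l => b # a).
  rewrite /T -!(colsumD, colsumB); apply: eq_colsum => b a y l.
  rewrite /neq; case: (eqVneq b a) => [_|ba] /=; first by ring.
  have dec c : (a != c)%:R * (b != c)%:R = (a != c)%:R + (b != c)%:R - 1 :> R.
    case: (eqVneq a c) => [<-|_] /=; first by rewrite ba /=; ring.
    by ring.
  rewrite -mulrA dec ![l == _]eq_sym dec; ring.
rewrite (swap (fun b a y l => b # y * l # b)).
rewrite (swap (fun b a y l => b # y * l # a)).
rewrite (swap (fun b a y l => b # y)) (swap (fun b a y l => l # b)) /T.
rewrite colsum_pendant colsum_cycle colsum_path_front colsum_path_back.
by rewrite colsum_disjoint_edge; ring.
Qed.

End Deletion.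
End Words.

(** * The rational expression *)

Section RationalExpression.
Variables (R : comAlgType rat) (E P Z X : zps R).
Local Notation e i := (zcoef E i).
Local Notation p i := (zcoef P i).
Local Notation c i := (zcoef Z i).

(** Tails from degree 3 of [E], [theta E] and [theta (theta E)]. Together with the low monomials
    [y1], [y2], [y3] they turn the whole identity into a polynomial one that [ring] decides. *)
Let A0 := sum_ge 3 (fun i => e i).
Let A1 := sum_ge 3 (fun i => i%:R * e i).
Let A2 := sum_ge 3 (fun i => i%:R * (i%:R * e i)).
Let y1 := e 1 *: zvar ^+ 1.
Let y2 := e 2 *: zvar ^+ 2.
Let y3 := e 3 *: zvar ^+ 3.

(** Trades rational scalars for multiplication inside the ring, the form suited to [ring]. *)
Lemma scale_quadratic (k l m i : nat) (a : R) :
  (k%:R * i%:R ^+ 2 - l%:R * i%:R + m%:R : rat) *: a =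
  k%:R * (i%:R * (i%:R * a)) - l%:R * (i%:R * a) + m%:R * a.
Proof.
rewrite -mulr_algl -[_%:A]/(in_alg R _).
rewrite rmorphD rmorphB !rmorphM !rmorph_nat; ring.
Qed.

Lemma sum_ge3_quadratic (k l m : nat) :
  sum_ge 3 (fun i => (k%:R * i%:R ^+ 2 - l%:R * i%:R + m%:R) *: e i) =
  k%:R * A2 - l%:R * A1 + m%:R * A0.
Proof.
apply: zpsP => n; rewrite zcoefD zcoefB !zcoef_natM /=.
case: ifP => _; last by rewrite !mulr0 subr0 addr0.
exact: scale_quadratic.
Qed.

Lemma edenE : e 0 = 1 -> E - theta E = 1 - y2 - (A1 - A0).
Proof.
move=> E0; apply: zpsP => n; rewrite !zcoefB zcoef1 zcoef_monom.
case: n => [|[|[|n]]] /=; rewrite ?E0; ring.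
Qed.

Lemma sum_ge2_eden : e 0 = 1 ->
  1 - sum_ge 2 (fun i => (i%:R - 1) *: e i) = E - theta E.
Proof.
move=> E0; apply: zpsP => n; rewrite !zcoefB zcoef1.
case: n => [|[|n]]; rewrite /= ?E0; [ring|ring|].
by rewrite scalerBl scaler_nat scale1r -mulr_natl; ring.
Qed.

Lemma egfE : e 0 = 1 -> E = 1 + y1 + y2 + A0.
Proof.
move=> E0; apply: zpsP => n; rewrite !zcoefD zcoef1 !zcoef_monom.
case: n => [|[|[|n]]] /=; rewrite ?E0; ring.
Qed.

Lemma theta_theta_egfE : e 0 = 1 ->
  theta (theta E) - theta E = A2 - A1 + 2 * y2.
Proof.
move=> E0; apply: zpsP => n.
rewrite zcoefB zcoefD zcoefB zcoef_natM zcoef_monom.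
case: n => [|[|[|n]]] /=; rewrite ?E0; ring.
Qed.

(** The formula for the coefficients of [X] holds only from degree 4 on, so each of the four series
    is truncated to the terms that land there. *)
Lemma half_twin_gfE :
  [/\ p 0 = 1, p 1 = e 1, p 2 = 2 * e 2 & p 3 = 3 * e 3 + e 1 * e 2] ->
  [/\ c 0 = 0, c 1 = 0, c 2 = 2 * e 2 & c 3 = 6 * e 3] ->
  (forall n, zcoef X n = if n is k.+4 then
    2 * (2 * c k.+4 + e 1 * c k.+3 - 3 * p k.+4 + e 2 * p k.+2) else 0) ->
  (2^-1)%:A *: X =
  2 * (Z - 2 * y2 - 6 * y3) + y1 * (Z - 2 * y2)
  - 3 * (P - 1 - y1 - 2 * y2 - 3 * y3 - y1 * y2) + y2 * (P - 1 - y1).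
Proof.
move=> [p0 p1 p2 p3] [c0 c1 c2 c3] XE.
have half (a : R) : (2^-1)%:A * (2 * a) = a.
  by rewrite mulr_algl mulr_natl -scaler_nat scalerA mulVf // scale1r.
apply: zpsP => n; rewrite zcoefZ XE.
rewrite !(zcoefD, zcoefN, zcoef_monomM, zcoef_natM, zcoef_monom, zcoef1).
case: n => [|[|[|[|n]]]] /=; rewrite ?half ?mulr0 ?subn1 ?subn2 /=.
- rewrite p0 c0; ring.
- rewrite p1 c0 c1; ring.
- rewrite p0 c1 p2 c2; ring.
- rewrite p1 c2 p3 c3; ring.
- ring.
Qed.

Lemma twin_gf_rational : e 0 = 1 ->
  [/\ p 0 = 1, p 1 = e 1, p 2 = 2 * e 2 & p 3 = 3 * e 3 + e 1 * e 2] ->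
  [/\ c 0 = 0, c 1 = 0, c 2 = 2 * e 2 & c 3 = 6 * e 3] ->
  (forall n, zcoef X n = if n is k.+4 then
    2 * (2 * c k.+4 + e 1 * c k.+3 - 3 * p k.+4 + e 2 * p k.+2) else 0) ->
  P * (E - theta E) = E -> Z * (E - theta E) = theta (theta E) - theta E ->
  let D := 1 - sum_ge 2 (fun i => (i%:R - 1) *: e i) in
  (2^-1)%:A *: X * D =
  sum_ge 4 (fun i => (2 * i%:R ^+ 2 - 5 * i%:R) *: e i) * D
  + (e 1 *: zvar * sum_ge 4 (fun i => ((i%:R - 1) * (i%:R - 3)) *: e i)
     + sum_ge 3 (fun i => (2 * i%:R ^+ 2 - 5 * i%:R) *: e i)
       * sum_ge 3 (fun i => (i%:R - 1) *: e i)
     + e 2 *: zvar ^+ 2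
       * sum_ge 3 (fun i => (2 * i%:R ^+ 2 - 6 * i%:R + 2) *: e i)).
Proof.
move=> E0 P_low Z_low XE PE ZE D.
rewrite /D sum_ge2_eden // (half_twin_gfE P_low Z_low XE) !sum_ge4E.
have -> : sum_ge 3 (fun i => (2 * i%:R ^+ 2 - 5 * i%:R) *: e i) =
    2 * A2 - 5 * A1.
  transitivity (sum_ge 3 (fun i =>
    (2%:R * i%:R ^+ 2 - 5%:R * i%:R + 0%:R : rat) *: e i)).
    by apply: eq_sum_ge => i; rewrite addr0.
  by rewrite sum_ge3_quadratic mul0r addr0.
have -> : sum_ge 3 (fun i => ((i%:R - 1) * (i%:R - 3)) *: e i) =
    A2 - 4 * A1 + 3 * A0.
  transitivity (sum_ge 3 (fun i =>
    (1%:R * i%:R ^+ 2 - 4%:R * i%:R + 3%:R : rat) *: e i)).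
    by apply: eq_sum_ge => i; congr (_ *: _); ring.
  by rewrite sum_ge3_quadratic mul1r.
have -> : sum_ge 3 (fun i => (i%:R - 1) *: e i) = A1 - A0.
  apply: zpsP => n; rewrite zcoefB /=; case: ifP; rewrite ?subr0 // => _.
  by rewrite scalerBl scaler_nat scale1r mulr_natl.
rewrite (sum_ge3_quadratic 2 6 2) -/y2.
have -> : (2 * 3%:R ^+ 2 - 5 * 3%:R : rat) *: e 3 *: (zvar ^+ 3 : zps R)
    = 3 * y3.
  have -> : 2 * 3%:R ^+ 2 - 5 * 3%:R = 3%:R :> rat by ring.
  by rewrite scaler_nat mulr_natl scalerMnl.
(* The factor [i - 3] vanishes at [i = 3], so the sum in [F3] may as well start at 3. *)
rewrite subrr mulr0 scale0r scale0r subr0 -[e 1 *: zvar]/y1.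
move: (theta_theta_egfE E0) (egfE E0) (edenE E0) PE ZE.
set D0 := E - _ => -> -> D0E PD ZD.
(* The expression is linear in [P] and [Z], which therefore enter only through [P * D0] and
   [Z * D0]. *)
have -> : (2 * (Z - 2 * y2 - 6 * y3) + y1 * (Z - 2 * y2)
    - 3 * (P - 1 - y1 - 2 * y2 - 3 * y3 - y1 * y2) + y2 * (P - 1 - y1)) * D0 =
  (2 + y1) * (Z * D0) + (y2 - 3) * (P * D0)
  + (3 + 3 * y1 + y2 - 3 * y3) * D0 by ring.
by rewrite PD ZD D0E; ring.
Qed.

End RationalExpression.

(** * Colorings of the twinned cycle *)

Definition chromatic_fin (R : comNzRingType) (C : finType) (x : C -> R)
    (G : sgraph) : R :=
  \sum_(kappa : {ffun G -> C}) (proper_coloring kappa)%:R * \prod_u x (kappa u).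

Lemma big_option (R : comNzRingType) (T : finType) (F : option T -> R) :
  \prod_o F o = F None * \prod_i F (Some i).
Proof.
rewrite (bigD1 None) //=; congr (_ * _).
rewrite (reindex_omap Some id) => [|[]//].
by apply: eq_bigl => i; rewrite eqxx.
Qed.

Section TwinnedCycle.
Variables (k : nat) (C : finType).
Local Notation n := k.+3.
Implicit Type t : n.-tuple C.

Lemma ordSE (i : 'I_n) : ordS i = i + 1.
Proof. by rewrite -(@add_Zp_1 n). Qed.

Lemma cycle_neqP t :
  reflect (forall i : 'I_n, tnth t i != tnth t (i + 1)) (cycle (@neq C) t).
Proof.
case: t => -[//|a s] sz /=.
have sz_s : size s = k.+2 by apply/eqP; rewrite -eqSS.
apply: (iffP (pathP a)) => [H i|H i].
  rewrite -ordSE !(tnth_nth a) /=.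
  have := H i; rewrite size_rcons sz_s ltn_ord => /(_ isT).
  rewrite /neq /= -rcons_cons !nth_rcons /= sz_s.
  rewrite ltn_ord; have := ltn_ord i.
  (* The last position is separate: its cyclic successor wraps round to 0. *)
  rewrite ltnS leq_eqVlt => /predU1P[->|lt_i].
    by rewrite modnn ltnn eqxx.
  by rewrite lt_i modn_small.
rewrite size_rcons sz_s => lt_i.
have := H (Ordinal lt_i); rewrite -ordSE !(tnth_nth a) /=.
rewrite /neq /= -rcons_cons !nth_rcons /= sz_s lt_i.
move: lt_i; rewrite ltnS leq_eqVlt => /predU1P[->|lt_i].
  by rewrite modnn ltnn eqxx.
by rewrite lt_i modn_small.
Qed.

Variable v : 'I_n.

(** Rotation by [v] moves the twinned vertex to position 0, so any choice of [v] leads to the same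
    [twin_word]. *)
Definition rot_coloring (bt : C * n.-tuple C) : {ffun option 'I_n -> C} :=
  [ffun o => if o is Some i then tnth bt.2 (i - v) else bt.1].

Lemma rot_coloring_bij : bijective rot_coloring.
Proof.
exists (fun f : {ffun option 'I_n -> C} =>
  (f None, [tuple f (Some (i + v)) | i < n])).
  move=> [b t]; congr (_, _); first by rewrite ffunE.
  by apply: eq_from_tnth => i; rewrite tnth_mktuple ffunE addrK.
move=> f; apply/ffunP => -[i|]; rewrite ffunE //=.
by rewrite tnth_mktuple subrK.
Qed.

Lemma twin_wordP b t : reflect
  [/\ b != tnth t 0, b != tnth t 1, b != tnth t (- 1) & cycle (@neq C) t]
  (twin_word b t).
Proof.
have vN1 : val (- 1 : 'I_n) = k.+2 by rewrite /= !modn_small.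
have -> : twin_word b t = [&& b != tnth t 0, b != tnth t 1,
    b != tnth t (- 1) & cycle (@neq C) t].
  rewrite !(tnth_nth b) vN1; case: t => -[|a [|y s]] // sz.
  have sz_s : size s = k.+1 by apply/eqP; rewrite -2!eqSS.
  by rewrite /= (neqC _ b) (last_nth b) sz_s.
exact: and4P.
Qed.

Lemma twin_proper_coloring b t :
  proper_coloring (rot_coloring (b, t) : {ffun twin (v : cycle_graph n) -> C})
  = twin_word b t.
Proof.
apply/idP/twin_wordP => [/forallP H|[b0 b1 bN1 /cycle_neqP cyc]].
  have {}H (o o' : option 'I_n) : twin_edge (v : cycle_graph n) o o' ->
      rot_coloring (b, t) o != rot_coloring (b, t) o'.
    by move=> e_oo'; have /forallP/(_ o')/implyP := H o; apply.
  have neq1 (i : 'I_n) : i != i + 1.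
    by rewrite -[X in X == _]addr0 (inj_eq (addrI i)) eq_sym.
  have edgeS (i : 'I_n) : cycle_edge i (i + 1).
    by rewrite /cycle_edge /= ordSE neq1 eqxx.
  split.
  - have := H None (Some v); rewrite !ffunE /= subrr eqxx; exact.
  - have := H None (Some (v + 1)); rewrite !ffunE /= [v + 1 - v]addrC addKr.
    by apply; rewrite edgeS orbT.
  - have := H None (Some (v - 1)).
    rewrite !ffunE /= addrAC subrr add0r; apply.
    have := edgeS (v - 1); rewrite subrK cycle_edge_sym => ->.
    by rewrite orbT.
  apply/cycle_neqP => i; have := H (Some (i + v)) (Some (i + v + 1)).
  rewrite !ffunE /= addrK [i + v + 1 - v]addrAC addrK.
  by apply; exact: edgeS.
have edge_Some (i j : 'I_n) : cycle_edge i j ->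
    tnth t (i - v) != tnth t (j - v).
  case/andP => _ /orP[] /eqP <-; rewrite ordSE addrAC //.
  by rewrite eq_sym.
have edge_None (i : 'I_n) : (i == v) || cycle_edge v i -> b != tnth t (i - v).
  case/predU1P => [->|]; first by rewrite subrr.
  case/andP => _ /orP[] /eqP; rewrite ordSE.
    by move=> <-; rewrite addrAC subrr add0r.
  by move/(canRL (addrK _)) ->; rewrite addrAC subrr add0r.
apply/forallP => -[i|]; apply/forallP => -[j|];
  apply/implyP; rewrite !ffunE //=.
- exact: edge_Some.
- by move/edge_None; rewrite eq_sym.
- exact: edge_None.
Qed.

Lemma chromatic_fin_twin (R : comNzRingType) (x : C -> R) :
  chromatic_fin x (twin (v : cycle_graph n)) =
  \sum_b wsum n (fun s => (twin_word b s)%:R * (x b * weight x s)).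
Proof.
rewrite /wsum pair_big /chromatic_fin.
rewrite (reindex rot_coloring) /=; last exact/onW_bij/rot_coloring_bij.
apply: eq_bigr => -[b t] _ /=; rewrite twin_proper_coloring; congr (_ * _).
rewrite big_option ffunE /=; congr (_ * _).
rewrite /weight big_tuple [RHS](reindex (fun i => i - v)).
  by apply: eq_bigr => i _; rewrite ffunE.
by exists (fun i => i + v) => i _; rewrite ?subrK ?addrK.
Qed.

End TwinnedCycle.

(** * Restriction to finitely many variables *)

Lemma mset_eq_seqP (m : monom) (s : seq nat) :
  (m == seq_mset s) = perm_eq (enum_mset m) s.
Proof.
rewrite -{1}(seq_mset_id m).
by apply/eqP/idP => /eq_seq_msetP.
Qed.

Definition mmon (m0 : monom) : mps := MPS (fun m => (m == m0)%:R).
Definition mvar (i : nat) : mps := mmon (seq_mset [:: i]).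

Lemma mcoef_sum (I : Type) (r : seq I) (p : pred I) (F : I -> mps) m :
  mcoef (\sum_(i <- r | p i) F i) m = \sum_(i <- r | p i) mcoef (F i) m.
Proof. exact: (big_morph (fun f => mcoef f m)). Qed.

Lemma mcoefM (f g : mps) m : mcoef (f * g) m =
  \sum_(a <- mdivs m) mcoef f a * mcoef g (m `\` a)%mset.
Proof. by []. Qed.

Lemma mmonM a b : mmon a * mmon b = mmon (a `+` b)%mset.
Proof.
apply: mpsP => m; rewrite mcoefM /=.
have [am|nam] := boolP (a `<=` m)%mset.
  rewrite (bigD1_seq a) ?mdivs_uniq ?mem_mdivs //= eqxx mul1r.
  rewrite big1; last by move=> c /negbTE ->; rewrite mul0r.
  rewrite addr0.
  congr (nat_of_bool _)%:R; apply/eqP/eqP => [<-|->]; last exact: msetDKB.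
  by rewrite msetBDKC.
rewrite big1_seq => [|c /andP[_]]; last first.
  rewrite mem_mdivs => cm; case: eqP => [eq_ca|]; last by rewrite mul0r.
  by rewrite -eq_ca cm in nam.
case: eqP => // eq_m; case/negP: nam; rewrite eq_m.
by apply/msubsetP => i; rewrite msetE2 leq_addr.
Qed.

Lemma prod_mvar (s : seq nat) : \prod_(i <- s) mvar i = mmon (seq_mset s).
Proof.
elim: s => [|i s IHs].
  rewrite big_nil; apply: mpsP => m /=; congr (nat_of_bool (_ == _))%:R.
  by apply/msetP => j; rewrite mset_seqE mset0E.
rewrite big_cons IHs mmonM; congr mmon; apply/msetP => j.
by rewrite msetE2 !mset_seqE /= addn0.
Qed.

Section Restriction.
Variable N : nat.

Definition bounded (m : monom) := all (fun i => (i < N)%N) (enum_mset m).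

Definition restrict (f : mps) : mps :=
  MPS (fun m => if bounded m then mcoef f m else 0).

Lemma boundedD (a b : monom) : bounded (a `+` b)%mset = bounded a && bounded b.
Proof.
apply/allP/andP => [H|[/allP Ha /allP Hb] i].
  by split; apply/allP => i ai; apply: H; rewrite in_msetD ai ?orbT.
by rewrite in_msetD => /orP[/Ha|/Hb].
Qed.

Lemma restrictD f g : restrict (f + g) = restrict f + restrict g.
Proof. by apply: mpsP => m /=; case: ifP; rewrite ?addr0. Qed.

Lemma restrictB f g : restrict (f - g) = restrict f - restrict g.
Proof. by apply: mpsP => m /=; case: ifP; rewrite ?subr0. Qed.

Lemma restrictZ c f : restrict (c *: f) = c *: restrict f.
Proof. by apply: mpsP => m /=; case: ifP; rewrite ?mulr0. Qed.

Lemma restrict0 : restrict 0 = 0.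
Proof. by apply: mpsP => m /=; case: ifP. Qed.

Lemma restrict_nat n : restrict n%:R = n%:R.
Proof.
elim: n => [|n IHn]; first exact: restrict0.
rewrite -natr1 restrictD IHn; congr (_ + _); apply: mpsP => m /=.
case: (eqVneq m mset0) => [->|_]; last by rewrite if_same.
by rewrite /bounded enum_mset0.
Qed.

(** A product of monomials is bounded exactly when both factors are. *)
Lemma restrictM f g : restrict (f * g) = restrict f * restrict g.
Proof.
apply: mpsP => m; rewrite mcoefM /=.
rewrite (_ : (if _ then _ else _) = \sum_(a <- mdivs m)
    if bounded m then mcoef f a * mcoef g (m `\` a)%mset else 0); last first.
  by case: ifP => // _; rewrite big1.
apply: eq_big_seq => a; rewrite mem_mdivs => am.
rewrite -{1}(msetBDKC am) boundedD.
by do 2!case: bounded; rewrite ?mul0r ?mulr0.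
Qed.

Lemma restrict_sum (I : Type) (r : seq I) (p : pred I) (F : I -> mps) :
  restrict (\sum_(i <- r | p i) F i) = \sum_(i <- r | p i) restrict (F i).
Proof. exact: (big_morph restrict restrictD restrict0). Qed.

End Restriction.

(** Each monomial involves finitely many indices, so it survives some restriction. Successors
    suffice, and they match the alphabets ['I_N.+1]. *)
Lemma restrict_inj (f g : mps) :
  (forall N, restrict N.+1 f = restrict N.+1 g) -> f = g.
Proof.
move=> eq_fg; apply: mpsP => m.
pose N := (\max_(i <- enum_mset m) i)%N.
have bm : bounded N.+1 m.
  by apply/allP => i im; rewrite ltnS /N (leq_bigmax_seq i).
by have := congr1 (fun h => mcoef h m) (eq_fg N); rewrite /= bm.
Qed.

Section FiniteAlphabet.
Variable N : nat.
Let x (i : 'I_N.+1) := mvar i.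

Lemma zcoef_egf_set k :
  zcoef (egf x) k = \sum_(J : {set 'I_N.+1} | #|J| == k) \prod_(i in J) x i.
Proof.
rewrite /egf; under eq_bigr do rewrite addrC.
rewrite bigA_distr zcoef_sum /= [RHS]big_mkcond /=; apply: eq_bigr => J _.
rewrite -big_mkcond /= scaler_prodr zcoefZ zcoef_zvarX eq_sym.
by case: eqP => _; rewrite ?mulr1 ?mulr0.
Qed.

Lemma restrict_elem k : restrict N.+1 (elem k) = zcoef (egf x) k.
Proof.
rewrite zcoef_egf_set; apply: mpsP => m; rewrite mcoef_sum /=.
have prodE (J : {set 'I_N.+1}) :
    mcoef (\prod_(i in J) x i) m
    = (perm_eq (enum_mset m) (map val (enum J)))%:R.
  by rewrite -big_enum -(big_map val predT mvar) prod_mvar /= mset_eq_seqP.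
under eq_bigr do rewrite prodE.
(* Only the set of indices occurring in [m] can contribute to its coefficient. *)
pose J0 := [set i : 'I_N.+1 | val i \in enum_mset m].
have permJ (J : {set 'I_N.+1}) : perm_eq (enum_mset m) (map val (enum J)) ->
    [/\ J = J0, uniq (enum_mset m), bounded N.+1 m & #|J| = size (enum_mset m)].
  move=> pmJ; split.
  - apply/setP => i; rewrite inE (perm_mem pmJ) mem_map ?mem_enum //.
    exact: val_inj.
  - by rewrite (perm_uniq pmJ) map_inj_uniq ?enum_uniq //; exact: val_inj.
  - by rewrite /bounded (perm_all _ pmJ); apply/allP => _ /mapP[i _ ->] /=.
  - by rewrite (perm_size pmJ) size_map -cardE.
rewrite (_ : (if _ then _ else _) =
  [&& bounded N.+1 m, size (enum_mset m) == k & uniq (enum_mset m)]%:R);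
  last by case: bounded.
have [/and3P[bm sm um]|ncond] := boolP [&& _, _ & _]; last first.
  rewrite big1 // => J /eqP kJ.
  case: (boolP (perm_eq _ _)) => // /permJ[_ um bm sJ].
  by rewrite bm um -sJ kJ eqxx in ncond.
have pm0 : perm_eq (enum_mset m) (map val (enum J0)).
  apply: uniq_perm => [//||i].
    by rewrite map_inj_uniq ?enum_uniq //; exact: val_inj.
  apply/idP/mapP => [im|[j]]; last by rewrite mem_enum inE => jm ->.
  have iN : (i < N.+1)%N by apply: (allP bm).
  by exists (Ordinal iN) => //; rewrite mem_enum inE.
have [_ _ _ s0] := permJ _ pm0.
rewrite (bigD1 J0) ?s0 //= pm0 big1 ?addr0 // => J /andP[_ neqJ].
case: (boolP (perm_eq _ _)) => // /permJ[eqJ _ _ _].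
by rewrite eqJ eqxx in neqJ.
Qed.

Lemma restrict_chromatic (G : sgraph) :
  restrict N.+1 (chromatic_symfun G) = chromatic_fin x G.
Proof.
apply: mpsP => m; rewrite mcoef_sum [LHS]/=.
pose colors C (f : C -> nat) (kappa : {ffun G -> C}) :=
  [seq f (kappa u) | u : G].
pose B := [set kappa : {ffun G -> 'I_N.+1} | proper_coloring kappa
  && perm_eq (enum_mset m) (colors _ val kappa)].
have termE (kappa : {ffun G -> 'I_N.+1}) :
    mcoef ((proper_coloring kappa)%:R * \prod_u x (kappa u)) m =
    (kappa \in B)%:R.
  rewrite -(big_image _ _ (fun u => val (kappa u)) predT mvar) prod_mvar inE.
  by case: proper_coloring; rewrite ?mul1r ?mul0r //= mset_eq_seqP.
rewrite (eq_bigr _ (fun kappa _ => termE kappa)) -natr_sum.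
have -> : \sum_kappa nat_of_bool (kappa \in B) = #|B|.
  by rewrite -sum1_card [RHS]big_mkcond; apply: eq_bigr => kappa _; case: ifP.
case: ifPn => [bm|nbm]; last first.
  rewrite (_ : B = set0) ?cards0 //; apply/setP => kappa; rewrite !inE.
  apply/negP => /andP[_ pm]; case/negP: nbm; rewrite /bounded (perm_all _ pm).
  by apply/allP => _ /mapP[u _ ->]; exact: ltn_ord.
pose A := [set kappa : {ffun G -> finsupp m} |
  proper_coloring kappa && (seq_mset [seq val (kappa u) | u : G] == m)].
(* For bounded [m], colorings by the support of [m] embed into colorings by ['I_N.+1]; the image is
   [B] because the colour multiset [m] forces all values into that support. *)
pose h (kappa : {ffun G -> finsupp m}) : {ffun G -> 'I_N.+1} :=
  [ffun u => inord (val (kappa u))].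
have hK kappa u : val (h kappa u) = val (kappa u).
  rewrite ffunE /= inordK //; apply: (allP bm).
  by rewrite -msuppE; exact: valP.
have h_inj : injective h.
  move=> k1 k2 eq_k; apply/ffunP => u; apply: val_inj.
  by rewrite -!hK eq_k.
suff -> : B = h @: A by rewrite card_imset.
have inA kappa : (kappa \in A) = (h kappa \in B).
  rewrite !inE [_ == m]eq_sym mset_eq_seqP.
  have -> : colors _ val (h kappa) = [seq val (kappa u) | u : G].
    by apply: eq_map => u; rewrite hK.
  congr (_ && _); apply: eq_forallb => u; apply: eq_forallb => w.
  by rewrite -!val_eqE !hK.
apply/setP => kappa; apply/idP/imsetP => [kB|[k' k'A ->]]; last by rewrite -inA.
have kP u : val (kappa u) \in finsupp m.
  move: kB; rewrite inE => /andP[_ pm]; rewrite msuppE.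
  by rewrite (perm_mem pm); apply/mapP; exists u; rewrite ?mem_enum.
have hk : kappa = h [ffun u => FSetSub (kP u)].
  by apply/ffunP => u; apply: val_inj; rewrite hK ffunE.
by exists [ffun u => FSetSub (kP u)]; rewrite // inA -hk.
Qed.

End FiniteAlphabet.

Definition zrestrict N (F : zps mps) : zps mps :=
  ZPS (fun n => restrict N (zcoef F n)).

Section ZRestrict.
Variable N : nat.

Lemma zrestrictD F G : zrestrict N (F + G) = zrestrict N F + zrestrict N G.
Proof. by apply: zpsP => n; exact: restrictD. Qed.

Lemma zrestrictB F G : zrestrict N (F - G) = zrestrict N F - zrestrict N G.
Proof. by apply: zpsP => n; exact: restrictB. Qed.

Lemma zrestrictM F G : zrestrict N (F * G) = zrestrict N F * zrestrict N G.
Proof.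
apply: zpsP => n; rewrite zcoefM /= restrict_sum.
by apply: eq_bigr => i _; rewrite restrictM.
Qed.

Lemma zrestrictZ c F : zrestrict N (c *: F) = restrict N c *: zrestrict N F.
Proof. by apply: zpsP => n; exact: restrictM. Qed.

Lemma zrestrict_zvarX k : zrestrict N (zvar ^+ k) = zvar ^+ k.
Proof. by apply: zpsP => n; rewrite /= zcoef_zvarX restrict_nat. Qed.

Lemma zrestrict1 : zrestrict N 1 = 1.
Proof. exact: (zrestrict_zvarX 0). Qed.

Lemma zrestrict_sum_ge k (c : nat -> rat) (f : nat -> mps) :
  zrestrict N (sum_ge k (fun i => c i *: f i)) =
  sum_ge k (fun i => c i *: restrict N (f i)).
Proof.
apply: zpsP => n /=; case: ifP => _; last exact: restrict0.
exact: restrictZ.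
Qed.

End ZRestrict.

Lemma zrestrict_inj (F G : zps mps) :
  (forall N, zrestrict N.+1 F = zrestrict N.+1 G) -> F = G.
Proof.
move=> eqFG; apply: zpsP => n; apply: restrict_inj => N.
exact: (congr1 (fun H : zps mps => zcoef H n) (eqFG N)).
Qed.

(** * Positivity in the elementary basis *)

(** Looser than [e_positive]: indices may repeat, be unsorted and contain 0, so sums and products
    only concatenate lists. *)
Definition ecomb (f : mps) := exists l : seq (rat * seq nat),
  all (fun q => 0 <= q.1) l /\ f = \sum_(q <- l) q.1 *: elem_part q.2.

Lemma elem0 : elem 0 = 1.
Proof.
apply: mpsP => m /=; rewrite size_mset_eq0.
by case: eqP => //= ->; rewrite enum_mset0.
Qed.

Lemma elem_part_sort la :
  elem_part (sort geq [seq i <- la | i != 0%N]) = elem_part la.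
Proof.
rewrite /elem_part (perm_big _ (permEl (perm_sort _ _))) big_filter.
rewrite [RHS](bigID (fun i => i != 0%N)) /=.
rewrite [X in _ = _ * X]big1 ?mulr1 // => i.
by rewrite negbK => /eqP->; exact: elem0.
Qed.

(** Each index is sorted and stripped of zeros, harmless since [elem 0 = 1], and the coefficients of
    equal partitions are added. *)
Lemma ecomb_e_positive f : ecomb f -> e_positive f.
Proof.
case=> l [/allP l_ge0 ->].
pose g (q : rat * seq nat) := sort geq [seq i <- q.2 | i != 0%N].
exists (undup (map g l)), (fun la => \sum_(q <- l | g q == la) q.1); split.
- exact: undup_uniq.
- apply/allP => la; rewrite mem_undup => /mapP[q _ ->]; apply/andP; split.
    by apply: sort_sorted => i j; exact: leq_total.
  by rewrite mem_sort mem_filter.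
- by move=> la _; rewrite big_seq_cond sumr_ge0 // => q /andP[/l_ge0].
under [RHS]eq_bigr do rewrite scaler_suml.
rewrite [RHS](exchange_big_dep xpredT) //= [LHS]big_seq [RHS]big_seq.
apply: eq_bigr => q ql; rewrite big_mkcond (bigD1_seq (g q)) ?undup_uniq //=.
  rewrite eqxx elem_part_sort big1 ?addr0 // => la /negbTE.
  by rewrite eq_sym => ->.
by rewrite mem_undup map_f.
Qed.

Lemma ecomb0 : ecomb 0.
Proof. by exists [::]; rewrite big_nil. Qed.

Lemma ecombD f g : ecomb f -> ecomb g -> ecomb (f + g).
Proof.
move=> [l [l_ge0 ->]] [l' [l'_ge0 ->]]; exists (l ++ l').
by rewrite all_cat l_ge0 l'_ge0 big_cat.
Qed.

Lemma ecombM f g : ecomb f -> ecomb g -> ecomb (f * g).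
Proof.
move=> [l [/allP l_ge0 ->]] [l' [/allP l'_ge0 ->]].
exists [seq (q.1 * q'.1, q.2 ++ q'.2) | q <- l, q' <- l']; split.
  apply/allP => _ /allpairsP[[q q'] /= [/l_ge0 q0 /l'_ge0 q'0 ->]] /=.
  exact: mulr_ge0.
rewrite big_allpairs_dep mulr_suml; apply: eq_bigr => q _.
rewrite mulr_sumr; apply: eq_bigr => q' _ /=.
by rewrite /elem_part big_cat /= -scalerAl -scalerAr scalerA.
Qed.

Lemma ecomb_elem c i : 0 <= c -> ecomb (c *: elem i).
Proof.
move=> c0; exists [:: (c, [:: i])]; split; first by rewrite /= c0.
by rewrite big_seq1 /elem_part big_seq1.
Qed.

Lemma ecomb1 : ecomb 1.
Proof. by rewrite -elem0 -[elem 0]scale1r; exact: ecomb_elem. Qed.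

Lemma ecomb_sum (I : Type) (r : seq I) (p : pred I) (F : I -> mps) :
  (forall i, p i -> ecomb (F i)) -> ecomb (\sum_(i <- r | p i) F i).
Proof. by apply: big_ind; [exact: ecomb0 | exact: ecombD]. Qed.

Definition ecomb_zps (F : zps mps) := forall n, ecomb (zcoef F n).

Lemma ecomb_zpsD F G : ecomb_zps F -> ecomb_zps G -> ecomb_zps (F + G).
Proof. by move=> HF HG n; rewrite zcoefD; exact: ecombD. Qed.

Lemma ecomb_zpsM F G : ecomb_zps F -> ecomb_zps G -> ecomb_zps (F * G).
Proof.
by move=> HF HG n; rewrite zcoefM; apply: ecomb_sum => i _; exact: ecombM.
Qed.

Lemma ecomb_zps_sum_ge k (c : nat -> rat) :
  (forall i, (k <= i)%N -> 0 <= c i) ->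
  ecomb_zps (sum_ge k (fun i => c i *: elem i)).
Proof.
move=> c_ge0 n /=; case: ifP => [/c_ge0|_]; last exact: ecomb0.
exact: ecomb_elem.
Qed.

Lemma ecomb_zps_monom i k : ecomb_zps (elem i *: zvar ^+ k).
Proof.
move=> n; rewrite zcoefZ zcoef_zvarX; case: eqP => _; rewrite ?mulr1 ?mulr0.
  by rewrite -[elem i]scale1r; exact: ecomb_elem.
exact: ecomb0.
Qed.

(** In [1/(1 - G) = 1 + G/(1 - G)] the missing constant term of [G] makes each coefficient depend
    only on earlier ones, whence strong induction. *)
Lemma ecomb_zpsV G : zcoef G 0 = 0 -> ecomb_zps G -> ecomb_zps (1 - G)^-1.
Proof.
move=> G0 HG.
have uG : 1 - G \is a GRing.unit by apply: zps_unit1; rewrite zcoefB G0 subr0.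
have VE : (1 - G)^-1 = 1 + G * (1 - G)^-1.
  by rewrite -[X in _ = X + _](divrr uG) -mulrDl subrK mul1r.
suff H m n : (n < m)%N -> ecomb (zcoef (1 - G)^-1 n).
  by move=> n; exact: (H n.+1).
elim: m n => // m IHm n; rewrite ltnS => le_nm.
rewrite VE zcoefD zcoefM big_ord_recl G0 mul0r add0r; apply: ecombD.
  by rewrite zcoef1; case: (n == 0)%N; [exact: ecomb1 | exact: ecomb0].
apply: ecomb_sum => i _; apply: ecombM; first exact: HG.
apply: IHm; apply: leq_trans le_nm.
by rewrite /= /bump /= add1n ltn_subrL /= (leq_ltn_trans _ (ltn_ord i)).
Qed.

(** * The twinned cycles *)

(** With the denominator cleared, restriction applies as a ring morphism and no inverse has to be
    transported. *)
Lemma twinned_cycle_gf_rational (v : forall k : nat, 'I_k.+3) :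
  let D := 1 - sum_ge 2 (fun i => (i%:R - 1) *: elem i) in
  (2^-1)%:A *: twinned_cycle_gf v * D =
  sum_ge 4 (fun i => (2 * i%:R ^+ 2 - 5 * i%:R) *: elem i) * D
  + (elem 1 *: zvar ^+ 1
       * sum_ge 4 (fun i => ((i%:R - 1) * (i%:R - 3)) *: elem i)
     + sum_ge 3 (fun i => (2 * i%:R ^+ 2 - 5 * i%:R) *: elem i)
       * sum_ge 3 (fun i => (i%:R - 1) *: elem i)
     + elem 2 *: zvar ^+ 2
       * sum_ge 3 (fun i => (2 * i%:R ^+ 2 - 6 * i%:R + 2) *: elem i)).
Proof.
move=> D; apply: zrestrict_inj => N; rewrite /D.
pose x (j : 'I_N.+1) := mvar j.
rewrite !(zrestrictB, zrestrictD, zrestrictM, zrestrictZ, zrestrict1,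
          zrestrict_zvarX, zrestrict_sum_ge).
have eE k c : sum_ge k (fun i => c i *: restrict N.+1 (elem i)) =
    sum_ge k (fun i => c i *: zcoef (egf x) i).
  by apply: eq_sum_ge => i; rewrite restrict_elem.
rewrite !eE !restrict_elem -/x.
have -> : restrict N.+1 (2^-1)%:A = (2^-1)%:A.
  by rewrite restrictZ (restrict_nat _ 1).
apply: (@twin_gf_rational _ _ (path_gf x) (cycle_gf x)).
- exact: zcoef_egf0.
- by have [? ? ?] := path_gf_low x; split=> //; exact: path_gf0.
- exact: cycle_gf_low.
- move=> n; rewrite [LHS]/=; case: n => [|[|[|[|k]]]]; rewrite ?restrict0 //.
  by rewrite restrict_chromatic chromatic_fin_twin twin_wordE.
- exact: path_gfE.
- exact: cycle_gfE.
Qed.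

Theorem theorem3p29 (v : forall k : nat, 'I_k.+3) :
  let gf : zps mps := (2^-1)%:A *: twinned_cycle_gf v in
  let F2 := sum_ge 3 (fun i => (2 * i%:R ^+ 2 - 5 * i%:R) *: elem i) in
  let F3 := sum_ge 4 (fun i => ((i%:R - 1) * (i%:R - 3)) *: elem i) in
  gf = sum_ge 4 (fun i => (2 * i%:R ^+ 2 - 5 * i%:R) *: elem i)
       + (elem 1 *: zvar * F3
          + F2 * sum_ge 3 (fun i => (i%:R - 1) *: elem i)
          + elem 2 *: zvar ^+ 2
            * sum_ge 3 (fun i => (2 * i%:R ^+ 2 - 6 * i%:R + 2) *: elem i))
         / (1 - sum_ge 2 (fun i => (i%:R - 1) *: elem i))
  /\ e_positive_zps gf.
Proof.
move=> gf F2 F3.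
set S4 := sum_ge 4 _; set S3 := sum_ge 3 (fun i => (i%:R - 1) *: _).
set S3' := sum_ge 3 (fun i => (_ - 6 * _ + _) *: _); set S2 := sum_ge 2 _.
set num := _ + _ + _; set D := 1 - S2.
have uD : D \is a GRing.unit by apply: zps_unit1; rewrite zcoefB subr0.
have gfE : gf = S4 + num / D.
  apply: (mulIr uD); rewrite mulrDl divrK //.
  exact: twinned_cycle_gf_rational.
split=> // n; apply: ecomb_e_positive; rewrite gfE; move: n.
(* The starting indices matter: [2 i^2 - 5 i] and [2 i^2 - 6 i + 2] are negative at [i = 2] but
   positive from 3 on. *)
have nat_ge k i : (k <= i)%N -> k%:R <= i%:R :> rat by rewrite ler_nat.
apply: ecomb_zpsD.
  by apply: ecomb_zps_sum_ge => i /nat_ge; nra.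
apply: ecomb_zpsM; last first.
  apply: ecomb_zpsV => //; apply: ecomb_zps_sum_ge => i /nat_ge; lra.
apply: ecomb_zpsD; first apply: ecomb_zpsD; apply: ecomb_zpsM.
- exact: (ecomb_zps_monom 1 1).
- by apply: ecomb_zps_sum_ge => i /nat_ge; nra.
- by apply: ecomb_zps_sum_ge => i /nat_ge; nra.
- by apply: ecomb_zps_sum_ge => i /nat_ge; lra.
- exact: ecomb_zps_monom.
- by apply: ecomb_zps_sum_ge => i /nat_ge; nra.
Qed.
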